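(* Let $A$ be a non-empty set. Then the norm of $FBL[\ell_1(A)]$ has the strong Nakano property: for every upwards directed, norm bounded set $\mathcal F\subseteq FBL[\ell_1(A)]_+$ there is an upper bound $y_0\in FBL[\ell_1(A)]$ of $\mathcal F$ with $\|y_0\|=\sup\{\|x\|:x\in\mathcal F\}$.
   Context: For a real Banach space $E$ with dual $E^*$ and closed unit ball $B_E$, let $H[E]$ be the vector space of all positively homogeneous functions $f:E^*\to\mathbb R$ ($f(\lambda x^* )=\lambda f(x^* )$ for $\lambda>0$). For $f\in H[E]$ put $\|f\|_{FBL[E]}:=\sup\{\sum_{k=1}^n|f(x_k^* )| : n\in\mathbb N,\ x_1^*,\dots,x_n^*\in E^*,\ \sup_{x\in B_E}\sum_{k=1}^n|x_k^*(x)|\le 1\}$. $H_0[E]:=\{f\in H[E]:\|f\|_{FBL[E]}<\infty\}$ is a Banach lattice with this norm and pointwise order/operations. For $x\in E$ let $\delta_x(x^* )=x^*(x)$. $FBL[E]$ is the closed sublattice of $H_0[E]$ generated by $\{\delta_x:x\in E\}$. Here $E=\ell_1(A)$, whose dual is identified with $\ell_\infty(A)$. For a Banach lattice $X$, $X_+=\{x\in X:x\ge0\}$. *)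

(* Defs.v *)
From HB Require Import structures.
From mathcomp Require Import all_boot all_order all_algebra.
From mathcomp Require Import all_classical all_reals.
From mathcomp Require Import ereal topology normedtype esum.
Set Implicit Arguments. Unset Strict Implicit. Unset Printing Implicit Defensive.
Import Order.TTheory GRing.Theory Num.Theory.
Local Open Scope ring_scope.
Local Open Scope classical_set_scope.

Section FBL_l1.
Variables (R : realType) (A : choiceType).

Definition l1norm (x : A -> R) : \bar R := (\esum_(a in [set: A]) (`|x a|)%:E)%E.
Definition in_l1 (x : A -> R) : Prop := (l1norm x < +oo)%E.
Definition in_ball_l1 (x : A -> R) : Prop := (l1norm x <= 1)%E.

(* E^* = l_infty(A): bounded families on A. *)
Definition bounded_fam (y : A -> R) : Prop := exists M : R, forall a, `|y a| <= M.
Record linf := Linf { lval :> A -> R ; lvalP : bounded_fam lval }.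

(* duality  x^*(x) = sum_a x^*(a) x(a)  (absolutely convergent sum, computed
   as difference of the sums of positive and negative parts) *)
Definition dpair (ys : linf) (x : A -> R) : R :=
  fine (\esum_(a in [set: A]) (Num.max (ys a * x a) 0)%:E)%E
  - fine (\esum_(a in [set: A]) (Num.max (- (ys a * x a)) 0)%:E)%E.

Definition pos_homog (f : linf -> R) : Prop :=
  forall (ys zs : linf) (lam : R), 0 < lam ->
    (forall a, zs a = lam * ys a) -> f zs = lam * f ys.

Definition admissible (n : nat) (xs : 'I_n -> linf) : Prop :=
  forall x : A -> R, in_ball_l1 x -> \sum_(k < n) `|dpair (xs k) x| <= 1.

Definition fbl_norm (f : linf -> R) : \bar R :=
  ereal_sup [set t : \bar R | exists (n : nat) (xs : 'I_n -> linf),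
                admissible xs /\ t = (\sum_(k < n) `|f (xs k)|)%:E].

Definition in_H0 (f : linf -> R) : Prop := pos_homog f /\ (fbl_norm f < +oo)%E.

Definition delta (x : A -> R) : linf -> R := fun ys => dpair ys x.

Definition closed_sublattice (S : set (linf -> R)) : Prop :=
  S `<=` in_H0 /\
  [/\       (forall f g, S f -> S g -> S (fun ys => f ys + g ys)),
      (forall (c : R) f, S f -> S (fun ys => c * f ys)),
      (forall f g, S f -> S g -> S (fun ys => Num.max (f ys) (g ys))),
      (forall f g, S f -> S g -> S (fun ys => Num.min (f ys) (g ys))) &
      (forall f, in_H0 f ->
         (forall e : R, 0 < e -> exists g, S g /\
             (fbl_norm (fun ys => (g ys - f ys)%R) < e%:E)%E) -> S f)].

Definition FBL : set (linf -> R) :=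
  fun f => forall S, closed_sublattice S ->
             (forall x, in_l1 x -> S (delta x)) -> S f.

Definition FBL_pos : set (linf -> R) :=
  fun f => FBL f /\ forall ys, 0 <= f ys.

Definition fle (f g : linf -> R) : Prop := forall ys, f ys <= g ys.

Definition upwards_directed (F : set (linf -> R)) : Prop :=
  (exists f, F f) /\
  forall f g, F f -> F g -> exists h, [/\ F h, fle f h & fle g h].

Definition norm_bounded (F : set (linf -> R)) : Prop :=
  exists M : R, forall f, F f -> (fbl_norm f <= M%:E)%E.

End FBL_l1.

(* Main.v *)
Require Import Defs.
From mathcomp Require Import all_boot all_order all_algebra.
From mathcomp Require Import all_classical all_reals.
From mathcomp Require Import ereal topology normedtype esum.
From mathcomp Require Import finmap lra.
Set Implicit Arguments. Unset Strict Implicit. Unset Printing Implicit Defensive.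
Import Order.TTheory GRing.Theory Num.Theory.
Local Open Scope ring_scope.
Local Open Scope classical_set_scope.

(** Testing on the basis vectors, admissibility of (x_k) in l_infty(A) means
    sum_k |x_k| <= 1 pointwise.  Let M be the supremum of the norms over F.
    Since F is directed, sum_k |x_k| <= t forces sum_k f(x_k) <= t M for f in F,
    so v |-> inf { t M - sum_k f(x_k) : f in F, v + sum_k |x_k| <= t } is a finite
    sublinear functional on the bounded functions.  Hahn-Banach yields a positive
    functional phi with phi 1 <= M and f(x) <= phi |x| for f in F.  Only its
    l_1 part c_a := phi 1_a is kept: sum_a c_a <= M, and f(x) <= sum_a c_a |x_a|
    for finitely supported x.  An element of FBL is the limit of its values on the
    finite restrictions of x, so the last bound holds for every x, and
    y0 := sum_a c_a |delta_a| is a norm-convergent series in FBL. *)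

(** * Hahn-Banach on a subspace [D]: minimal sublinear functionals *)

Section HahnBanach.
Variables (R : realType) (V : lmodType R) (D : set V).
Hypothesis D0 : D 0.
Hypothesis DD : forall v w, D v -> D w -> D (v + w).
Hypothesis DZ : forall (a : R) v, D v -> D (a *: v).

Definition sublinear_on (p : V -> R) : Prop :=
  (forall v w, D v -> D w -> p (v + w) <= p v + p w) /\
  (forall a v, 0 < a -> D v -> p (a *: v) = a * p v).

Lemma sublinear_on0 p : sublinear_on p -> p 0 = 0.
Proof.
by move=> [_ /(_ 2 0 ltac:(lra) D0)]; rewrite scaler0 => ?; lra.
Qed.

Lemma domainN v : D v -> D (- v).
Proof. by move=> /(DZ (-1)); rewrite scaleN1r. Qed.

Lemma sublinear_on_geN p v : sublinear_on p -> D v -> - p (- v) <= p v.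
Proof.
move=> sp Dv; have := sp.1 _ _ Dv (domainN Dv).
by rewrite subrr (sublinear_on0 sp) => ?; lra.
Qed.

(** Serves three infima: over a chain, over the ray v + t w, and over the sets [upper] below.
    Homogeneity is assumed as an inequality only; using it for a and for a^-1 gives equality. *)
Lemma inf_sublinear_on (G : V -> set R) :
  (forall v, D v -> has_inf (G v)) ->
  (forall v w r s, D v -> D w -> G v r -> G w s ->
     exists2 u, G (v + w) u & u <= r + s) ->
  (forall a v r, 0 < a -> D v -> G v r ->
     exists2 u, G (a *: v) u & u <= a * r) ->
  sublinear_on (fun v => inf (G v)).
Proof.
move=> Ginf GD GZ.
have infZ_le a v : 0 < a -> D v -> inf (G (a *: v)) <= a * inf (G v).
  move=> a0 Dv; rewrite mulrC -ler_pdivrMr//; apply: lb_le_inf => [|r Gr].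
    exact: (Ginf _ Dv).1.
  have [u Gu uar] := GZ a v r a0 Dv Gr.
  rewrite ler_pdivrMr// mulrC; apply: le_trans uar.
  by apply: ge_inf => //; exact: (Ginf _ (DZ a Dv)).2.
split=> [v w Dv Dw|a v a0 Dv].
- rewrite -lerBlDr; apply: lb_le_inf => [|r Gr]; first exact: (Ginf _ Dv).1.
  rewrite lerBlDr -lerBlDl; apply: lb_le_inf => [|s Gs].
    exact: (Ginf _ Dw).1.
  have [u Gu urs] := GD v w r s Dv Dw Gr Gs.
  rewrite lerBlDl; apply: le_trans urs.
  by apply: ge_inf => //; exact: (Ginf _ (DD Dv Dw)).2.
- apply/eqP; rewrite eq_le infZ_le//=.
  have av0 : 0 < a^-1 by rewrite invr_gt0.
  have := infZ_le _ _ av0 (DZ a Dv).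
  rewrite scalerA mulVf ?gt_eqF// scale1r.
  by rewrite -(ler_pM2l a0) mulrA mulfV ?gt_eqF// mul1r.
Qed.

Variable q : V -> R.
Hypothesis sq : sublinear_on q.

Let below (p : V -> R) := sublinear_on p /\ forall v, D v -> p v <= q v.

(** Zorn's lemma. A nonempty chain is bounded by its pointwise infimum, finite because every member
    t satisfies - q (- v) <= - t (- v) <= t v. *)
Let minimal_below :
  exists2 p, below p & forall p', below p' -> (forall v, D v -> p' v <= p v) ->
    forall v, D v -> p v <= p' v.
Proof.
pose T := {p : V -> R | below p}.
(* The order is reversed, so a maximal element for [Rel] is a minimal functional. *)
pose Rel (s t : T) := `[< forall v, D v -> sval t v <= sval s v >].
have [||A Atot|[p bp] pmax] := @ZL_preorder T (exist _ q (conj sq (fun _ _ => lexx _))) Rel.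
- by move=> t; apply/asboolP.
- move=> r s t /asboolP rs /asboolP st; apply/asboolP => v Dv.
  exact: le_trans (st v Dv) (rs v Dv).
- have [[t0 At0]|A0] := pselect (exists t, A t); last first.
    exists (exist _ q (conj sq (fun _ _ => lexx _))) => s As.
    by case: A0; exists s.
  pose G v := [set sval t v | t in A].
  have Ginf v : D v -> has_inf (G v).
    move=> Dv; split; first by exists (sval t0 v), t0.
    exists (- q (- v)) => _ [t At <-].
    have [st tq] := svalP t.
    apply: le_trans (sublinear_on_geN st Dv).
    by rewrite lerN2; apply/tq/domainN.
  have sG : sublinear_on (fun v => inf (G v)).
    apply: inf_sublinear_on => //.
      move=> v w _ _ Dv Dw [s As <-] [t At <-].
      case: (Atot s t As At) => /asboolP st.
        exists (sval t (v + w)); first by exists t.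
        by apply: le_trans ((svalP t).1.1 _ _ Dv Dw) _; rewrite lerD2r st.
      exists (sval s (v + w)); first by exists s.
      by apply: le_trans ((svalP s).1.1 _ _ Dv Dw) _; rewrite lerD2l st.
    move=> a v _ a0 Dv [s As <-]; exists (sval s (a *: v)); first by exists s.
    by rewrite (svalP s).1.2.
  have bG : below (fun v => inf (G v)).
    split=> // v Dv; apply: le_trans ((svalP t0).2 v Dv).
    by apply: ge_inf; [exact: (Ginf v Dv).2|exists t0].
  exists (exist _ _ bG) => s As; apply/asboolP => v Dv /=.
  by apply: ge_inf; [exact: (Ginf v Dv).2|exists s].
- exists p => // p' bp' p'p v Dv.
  have /asboolP := pmax (exist _ p' bp') ltac:(exact/asboolP).
  exact.
Qed.

(* A minimal sublinear functional is additive: comparing p with the sublinear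
   functional inf_(t >= 0) (p (v + t w) - t p w) gives p v + p w <= p (v + w). *)
Theorem hahn_banach_additive :
  exists p : V -> R, [/\ forall v w, D v -> D w -> p (v + w) = p v + p w,
    forall a v, 0 < a -> D v -> p (a *: v) = a * p v &
    forall v, D v -> p v <= q v].
Proof.
have [p [sp pq] pmin] := minimal_below.
exists p; split=> // [v w Dv Dw|]; last exact: sp.2.
apply/eqP; rewrite eq_le sp.1//= -lerBrDr.
have pZ t : 0 <= t -> p (t *: w) = t * p w.
  rewrite le_eqVlt => /predU1P[<-|t0]; last exact: sp.2.
  by rewrite scale0r mul0r sublinear_on0.
pose G u := [set p (u + t *: w) - t * p w | t in [set t | 0 <= t]].
have Ginf u : D u -> has_inf (G u).
  move=> Du; split; first by exists (p (u + 0 *: w) - 0 * p w), 0 => /=.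
  (* Lower bound: t p w = p (t w) <= p (u + t w) + p (- u). *)
  exists (- p (- u)) => _ [t /= t0 <-].
  have := sp.1 _ _ (DD Du (DZ t Dw)) (domainN Du).
  by rewrite addrAC subrr add0r pZ// => ?; lra.
have Gle t u : 0 <= t -> D u -> inf (G u) <= p (u + t *: w) - t * p w.
  by move=> t0 Du; apply: ge_inf; [exact: (Ginf u Du).2|exists t].
have Gp u : D u -> inf (G u) <= p u.
  by move=> Du; have := Gle 0 u (lexx _) Du; rewrite scale0r addr0 mul0r subr0.
have sG : sublinear_on (fun u => inf (G u)).
  apply: inf_sublinear_on => //.
    move=> u1 u2 _ _ Du1 Du2 [t /= t0 <-] [t' /= t'0 <-].
    exists (p (u1 + u2 + (t + t') *: w) - (t + t') * p w).
      by exists (t + t') => //=; rewrite addr_ge0.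
    rewrite scalerDl addrACA.
    by have := sp.1 _ _ (DD Du1 (DZ t Dw)) (DD Du2 (DZ t' Dw)); lra.
  move=> a u _ a0 Du [t /= t0 <-].
  exists (p (a *: u + (a * t) *: w) - a * t * p w).
    by exists (a * t) => //=; rewrite mulr_ge0// ltW.
  rewrite -scalerA -scalerDr sp.2//; last exact/DD/DZ.
  by rewrite mulrBr mulrA.
have bG : below (fun u => inf (G u)).
  by split=> // u Du; apply: le_trans (Gp u Du) (pq u Du).
(* Minimality gives p v <= inf (G v), and t = 1 bounds the latter by p (v + w) - p w. *)
apply: le_trans (pmin _ bG Gp v Dv) _.
by have := Gle 1 v ler01 Dv; rewrite scale1r mul1r.
Qed.

End HahnBanach.

(** * Unordered sums and the pairing of l_1(A) with l_infty(A) *)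

Section Duality.
Variables (R : realType) (A : choiceType).
Implicit Types (ys zs : linf R A) (x : A -> R) (S : set A).

Lemma esumZl S (u : A -> R) (lam : R) : 0 < lam ->
  (\esum_(a in S) (lam * u a)%:E = lam%:E * \esum_(a in S) (u a)%:E)%E.
Proof.
move=> lam0; rewrite /esum -ereal_sup_pZl//; congr ereal_sup.
apply/seteqP; split=> [_ [X [finX XS] <-]|_ [_ [X [finX XS] <-] <-]] /=.
  exists (\sum_(a \in X) (u a)%:E)%E; first by exists X.
  by rewrite !fsumEFin// -EFinM fsbig_finite//= mulr_sumr -fsbig_finite.
exists X => //.
by rewrite !fsumEFin// -EFinM [in RHS]fsbig_finite//= mulr_sumr -fsbig_finite.
Qed.

(** A finite partial sum within e of the supremum leaves a remainder below e. *)
Lemma esum_tail (u : A -> R) (e : R) : (forall a, 0 <= u a) ->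
  (\esum_(a in [set: A]) (u a)%:E < +oo)%E -> 0 < e ->
  exists2 S, finite_set S & (\esum_(a in ~` S) (u a)%:E < e%:E)%E.
Proof.
move=> u0 uoo e0.
have ufin S : (\esum_(a in S) (u a)%:E)%E \is a fin_num.
  rewrite ge0_fin_numE; last by apply: esum_ge0 => ? _; rewrite lee_fin.
  apply: le_lt_trans uoo; rewrite esum_mkcond; apply: le_esum => a _.
  by case: ifP; rewrite lee_fin.
have [_ [S [finS _] <-] uS] := ub_ereal_sup_adherent e0 (ufin setT).
exists S => //; move: uS.
rewrite -/(esum _ _) (esumID S) ?setTI; last by move=> a _; rewrite lee_fin.
rewrite -esum_fset//; last by move=> a _; rewrite lee_fin.
move: (ufin S) (ufin (~` S)).
case: (\esum_(a in S) _)%E => // p _; case: (\esum_(a in ~` S) _)%E => // r _.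
rewrite -EFinD -EFinB !lte_fin => ?; lra.
Qed.

Lemma restr_bounded S ys : bounded_fam (fun a => if a \in S then ys a else 0).
Proof.
have [M yM] := lvalP ys; exists `|M| => a; case: ifP => _.
  exact: le_trans (yM a) (ler_norm M).
by rewrite normr0.
Qed.

Definition restr S ys : linf R A := Linf (@restr_bounded S ys).

Lemma abs_bounded ys : bounded_fam (fun a => `|ys a|).
Proof. by have [M yM] := lvalP ys; exists M => a; rewrite normr_id. Qed.

Definition abs_linf ys : linf R A := Linf (@abs_bounded ys).

Lemma scale_bounded (lam : R) ys : bounded_fam (fun a => lam * ys a).
Proof.
have [M yM] := lvalP ys; exists (`|lam| * M) => a.
by rewrite normrM ler_wpM2l.
Qed.

Definition scale_linf lam ys : linf R A := Linf (@scale_bounded lam ys).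

(** The bound is made strictly positive so that it can be divided by. *)
Lemma linf_boundP ys : exists2 M : R, 0 < M & forall a, `|ys a| <= M.
Proof.
have [M yM] := lvalP ys; exists (`|M| + 1) => [|a].
  by rewrite ltr_wpDl.
by rewrite (le_trans (yM a))// (le_trans (ler_norm M))// lerDl.
Qed.

Lemma esum_pairing_le S ys x (M : R) : 0 < M -> (forall a, `|ys a| <= M) ->
  (\esum_(a in S) `|ys a * x a|%:E <= M%:E * \esum_(a in S) `|x a|%:E)%E.
Proof.
move=> M0 yM; rewrite -esumZl//; apply: le_esum => a _.
by rewrite lee_fin normrM ler_wpM2r.
Qed.

Lemma esum_subset_le S (u : A -> R) : (forall a, 0 <= u a) ->
  (\esum_(a in S) (u a)%:E <= \esum_(a in [set: A]) (u a)%:E)%E.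
Proof.
move=> u0; rewrite esum_mkcond; apply: le_esum => a _.
by case: ifP; rewrite lee_fin.
Qed.

Lemma summable_pairing ys x : in_l1 x ->
  (\esum_(a in [set: A]) `|ys a * x a|%:E < +oo)%E.
Proof.
have [M M0 yM] := linf_boundP ys => xl1.
apply: le_lt_trans (esum_pairing_le setT x M0 yM) _.
by rewrite lte_mul_pinfty// ?lee_fin ?ltW.
Qed.

(** Makes the sums of positive and negative parts finite, so that [fine] loses nothing. *)
Let posneg_fin S (u : A -> R) (v : A -> R) :
  (\esum_(a in [set: A]) `|u a|%:E < +oo)%E ->
  (forall a, 0 <= v a) -> (forall a, v a <= `|u a|) ->
  (\esum_(a in S) (v a)%:E)%E \is a fin_num.
Proof.
move=> uoo v0 vu; rewrite ge0_fin_numE; last first.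
  by apply: esum_ge0 => a _; rewrite lee_fin.
apply: le_lt_trans uoo; apply: le_trans (esum_subset_le _ v0) _.
by apply: le_esum => a _; rewrite lee_fin.
Qed.

(** With P and N the sums of the positive and negative parts, |P - N| <= P + N; an infinite
    right-hand side is trivial. *)
Lemma dpair_abs_le ys x :
  (`|dpair ys x|%:E <= \esum_(a in [set: A]) `|ys a * x a|%:E)%E.
Proof.
have [Doo|] := ltP (\esum_(a in [set: A]) `|ys a * x a|%:E)%E +oo%E; last first.
  by rewrite leye_eq => /eqP ->; rewrite leey.
rewrite /dpair.
set P := (X in fine X - _); set N := (X in _ - fine X).
have max0 (u : R) : 0 <= Num.max u 0 by rewrite le_max lexx orbT.
have maxP (u : R) : Num.max u 0 <= `|u| by rewrite ge_max ler_norm normr_ge0.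
have Pfin : P \is a fin_num by apply: posneg_fin Doo _ _.
have Nfin : N \is a fin_num.
  by apply: posneg_fin Doo _ _ => // a; rewrite -normrN.
have -> : (\esum_(a in [set: A]) `|ys a * x a|%:E = P + N)%E.
  rewrite -esumD; try by move=> a _; rewrite lee_fin.
  apply: eq_esum => a _; rewrite -EFinD; congr EFin.
  have /orP[u0|u0] := le_total 0 (ys a * x a).
    by rewrite ger0_norm// max_l// max_r ?oppr_le0// addr0.
  by rewrite ler0_norm// max_r// max_l ?oppr_ge0// add0r.
rewrite -(fineK Pfin) -(fineK Nfin) -EFinD lee_fin.
have P0 : 0 <= fine P by rewrite fine_ge0// esum_ge0// => a _; rewrite lee_fin.
have N0 : 0 <= fine N by rewrite fine_ge0// esum_ge0// => a _; rewrite lee_fin.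
by rewrite ler_norml; apply/andP; split; lra.
Qed.

Lemma dpair_restr S ys x : in_l1 x ->
  dpair ys x = dpair (restr S ys) x + dpair (restr (~` S) ys) x.
Proof.
move=> xl1; have Doo := summable_pairing ys xl1.
have max0 (u : R) : 0 <= Num.max u 0 by rewrite le_max lexx orbT.
have maxP (u : R) : Num.max u 0 <= `|u| by rewrite ge_max ler_norm normr_ge0.
(* Taking [g] as the identity and as negation treats both parts of the pairing at once. *)
have split_esum (g : R -> R) : (forall r, `|g r| = `|r|) -> g 0 = 0 ->
    fine (\esum_(a in [set: A]) (Num.max (g (ys a * x a)) 0)%:E)%E =
    fine (\esum_(a in [set: A]) (Num.max (g (restr S ys a * x a)) 0)%:E)%E +
    fine (\esum_(a in [set: A]) (Num.max (g (restr (~` S) ys a * x a)) 0)%:E)%E.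
  move=> gnorm g0.
  have restrE S' : (\esum_(a in [set: A])
      (Num.max (g (restr S' ys a * x a)) 0)%:E =
      \esum_(a in S') (Num.max (g (ys a * x a)) 0)%:E)%E.
    rewrite [RHS]esum_mkcond; apply: eq_esum => a _ /=.
    by case: ifP => // _; rewrite mul0r g0 maxxx.
  have fin S' : (\esum_(a in S') (Num.max (g (ys a * x a)) 0)%:E)%E
      \is a fin_num.
    apply: posneg_fin Doo _ _ => // a.
    by apply: le_trans (maxP _) _; rewrite gnorm.
  rewrite !restrE -fineD// (esumID S) ?setTI//.
  by move=> a _; rewrite lee_fin.
have sp := split_esum id (fun=> erefl) erefl.
have sn := split_esum -%R (@normrN _ _) (@oppr0 _).
by rewrite /dpair sp sn opprD addrACA.
Qed.

End Duality.

(** * The free norm in coordinates, and continuity of elements of FBL along restrictions *)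

Section FreeNorm.
Variables (R : realType) (A : choiceType).
Implicit Types (ys zs : linf R A) (x : A -> R) (S : set A) (f g h : linf R A -> R).

Definition basis (a : A) : A -> R := fun b => (b == a)%:R.

Let esum_basis (a : A) (u : A -> R) : (forall b, b != a -> u b = 0) ->
  0 <= u a -> (\esum_(b in [set: A]) (u b)%:E)%E = (u a)%:E.
Proof.
move=> u0 ua; rewrite -(@esum_set1 R _ a (fun b => (u b)%:E)) ?lee_fin//.
rewrite [RHS]esum_mkcond; apply: eq_esum => b _; rewrite in_set1.
by case: eqVneq => // ba; rewrite u0.
Qed.

Lemma dpair_basis ys a : dpair ys (basis a) = ys a.
Proof.
rewrite /dpair !(esum_basis (a := a)) /basis ?eqxx ?mulr1 ?le_max ?lexx ?orbT//.
- have /orP[y0|y0] := le_total 0 (ys a).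
    by rewrite max_l// max_r ?oppr_le0// subr0.
  by rewrite max_r// max_l ?oppr_ge0// opprK add0r.
- by move=> b /negPf ->; rewrite mulr0 oppr0 maxxx.
- by move=> b /negPf ->; rewrite mulr0 maxxx.
Qed.

Lemma l1norm_basis a : l1norm (basis a) = 1%E.
Proof.
rewrite /l1norm (esum_basis (a := a)) /basis ?eqxx ?normr1//.
by move=> b /negPf ->; rewrite normr0.
Qed.

Lemma dpair_pos_homog x : pos_homog (fun ys => dpair ys x).
Proof.
move=> ys zs lam lam0 zsE; rewrite /dpair.
have scale (g : R -> R) : (forall r, g (lam * r) = lam * g r) ->
    fine (\esum_(a in [set: A]) (Num.max (g (zs a * x a)) 0)%:E)%E =
    lam * fine (\esum_(a in [set: A]) (Num.max (g (ys a * x a)) 0)%:E)%E.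
  move=> gM; rewrite -[lam in RHS]/(fine lam%:E).
  under eq_esum => a _.
    rewrite zsE -mulrA gM -[X in Num.max _ X](mulr0 lam) -maxr_pMr ?ltW//.
    over.
  (* Here [x] is arbitrary; in the infinite cases both sides are 0, since [fine] sends the
     infinities to 0. *)
  rewrite esumZl//; case: (\esum_(_ in _) _)%E => [r//||].
    by rewrite gt0_muley ?lte_fin//= mulr0.
  by rewrite gt0_muleNy ?lte_fin//= mulr0.
rewrite mulrBr; congr (_ - _); first exact: (scale id).
by apply: (scale -%R) => r; rewrite mulrN.
Qed.

(** Exchanges the finite and the unordered sum. The weight [w] will be 1 for norm bounds and an
    indicator for tails. *)
Lemma sum_dpair_le n (xs : 'I_n -> linf R A) x (w : A -> R) :
  (forall a, \sum_(k < n) `|xs k a| <= w a) ->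
  ((\sum_(k < n) `|dpair (xs k) x|)%:E <=
    \esum_(a in [set: A]) (w a * `|x a|)%:E)%E.
Proof.
move=> xsw; rewrite -sumEFin.
apply: (@le_trans _ _ (\sum_(k < n) \esum_(a in [set: A]) `|xs k a * x a|%:E)%E).
  by apply: lee_sum => k _; exact: dpair_abs_le.
rewrite -esum_sum; last by move=> a k _ _; rewrite lee_fin.
apply: le_esum => a _; rewrite sumEFin lee_fin.
under eq_bigr do rewrite normrM.
by rewrite -mulr_suml ler_wpM2r.
Qed.

Lemma sum_dpair_restr_le n (xs : 'I_n -> linf R A) x S :
  (forall a, \sum_(k < n) `|xs k a| <= 1) ->
  ((\sum_(k < n) `|dpair (restr S (xs k)) x|)%:E <=
    \esum_(a in S) `|x a|%:E)%E.
Proof.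
move=> xs1; apply: le_trans (@sum_dpair_le _ _ _ (fun a => (a \in S)%:R) _) _.
  move=> a /=; case: (a \in S) => //.
  by rewrite big1// => k _; rewrite normr0.
rewrite [leRHS]esum_mkcond; apply: le_esum => a _.
by case: ifP => _; rewrite ?mul1r ?mul0r.
Qed.

(* The extreme points of the ball of l_1(A) are the signed basis vectors. *)
Lemma admissibleP n (xs : 'I_n -> linf R A) :
  admissible xs <-> forall a, \sum_(k < n) `|xs k a| <= 1.
Proof.
split=> [adm a|xs1 x xball].
  have := adm (basis a); rewrite /in_ball_l1 l1norm_basis => /(_ (lexx _)).
  by under eq_bigr do rewrite dpair_basis.
rewrite -lee_fin; apply: le_trans xball.
apply: le_trans (@sum_dpair_le _ _ _ (fun=> 1) _) _ => //.
by apply: le_esum => a _; rewrite mul1r.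
Qed.

Lemma fbl_norm_leP f (M : R) : (fbl_norm f <= M%:E)%E <->
  forall n (xs : 'I_n -> linf R A), (forall a, \sum_(k < n) `|xs k a| <= 1) ->
    \sum_(k < n) `|f (xs k)| <= M.
Proof.
split=> [fM n xs /admissibleP adm|fM].
  rewrite -lee_fin; apply: le_trans fM; apply: ereal_sup_ubound.
  by exists n, xs.
apply: ge_ereal_sup => _ [n [xs [/admissibleP adm ->]]].
by rewrite lee_fin fM.
Qed.

Lemma fbl_norm_ge0 f : (0 <= fbl_norm f)%E.
Proof.
(* The empty family is admissible and contributes 0. *)
apply: ereal_sup_ubound; exists 0%N, (tnth (nil_tuple _)); rewrite big_ord0.
by split=> // x _; rewrite big_ord0.
Qed.

Lemma in_H0_bound f : in_H0 f -> exists2 M : R, 0 <= M & (fbl_norm f <= M%:E)%E.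
Proof.
move=> [_ foo]; have f0 := fbl_norm_ge0 f.
have ffin : fbl_norm f \is a fin_num by rewrite ge0_fin_numE.
by exists (fine (fbl_norm f)); rewrite ?fine_ge0// fineK.
Qed.

(** For t > 0 the family is rescaled by t^-1; for t = 0 all its members vanish. *)
Lemma fbl_norm_sum_le n (xs : 'I_n -> linf R A) f (M t : R) :
  pos_homog f -> (fbl_norm f <= M%:E)%E -> 0 <= t ->
  (forall a, \sum_(k < n) `|xs k a| <= t) ->
  \sum_(k < n) `|f (xs k)| <= t * M.
Proof.
move=> fh /fbl_norm_leP fM; rewrite le_eqVlt => /predU1P[<-|t0] xst.
  rewrite mul0r big1// => k _.
  have xs0 a : xs k a = 0.
    have /psumr_eq0P : \sum_(k < n) `|xs k a| = 0.
      by apply/eqP; rewrite eq_le xst/= sumr_ge0.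
    by move=> /(_ (fun _ _ => normr_ge0 _) k isT)/eqP; rewrite normr_eq0 => /eqP.
  (* Homogeneity with factor 2 at the zero family reads f 0 = 2 f 0. *)
  have := fh (xs k) (xs k) 2 ltac:(lra) (fun a => ltac:(rewrite xs0; lra)).
  by move=> fk; rewrite (_ : f _ = 0) ?normr0//; lra.
have fE k : f (xs k) = t * f (scale_linf t^-1 (xs k)).
  by apply: fh => // a /=; rewrite mulrA mulfV ?gt_eqF// mul1r.
under eq_bigr do rewrite fE normrM (gtr0_norm t0).
rewrite -mulr_sumr ler_pM2l//; apply: fM => a /=.
under eq_bigr do rewrite normrM gtr0_norm ?invr_gt0//.
by rewrite -mulr_sumr mulrC ler_pdivrMr// mul1r.
Qed.

(** Lists are convenient later, where two families get concatenated. *)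
Lemma fbl_norm_sum_seq_le (s : seq (linf R A)) f (M t : R) :
  pos_homog f -> (fbl_norm f <= M%:E)%E -> 0 <= t ->
  (forall a, \sum_(y <- s) `|y a| <= t) ->
  \sum_(y <- s) `|f y| <= t * M.
Proof.
move=> fh fM t0 st; rewrite big_tnth; apply: fbl_norm_sum_le => // a.
by have := st a; rewrite big_tnth.
Qed.

Lemma fbl_norm_point_le ys f (M t : R) :
  pos_homog f -> (fbl_norm f <= M%:E)%E -> 0 <= t ->
  (forall a, `|ys a| <= t) -> `|f ys| <= t * M.
Proof.
move=> fh fM t0 yt.
have := @fbl_norm_sum_seq_le [:: ys] f M t fh fM t0.
by rewrite big_seq1; apply => a; rewrite big_seq1.
Qed.

Lemma in_H0_dom f g h (C : R) : 0 <= C -> in_H0 f -> in_H0 g -> pos_homog h ->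
  (forall ys, `|h ys| <= C * (`|f ys| + `|g ys|)) -> in_H0 h.
Proof.
move=> C0 /in_H0_bound[M M0 /fbl_norm_leP fM].
move=> /in_H0_bound[N N0 /fbl_norm_leP gN] hh hC; split=> //.
apply: le_lt_trans (ltry (C * (M + N))); apply/fbl_norm_leP => n xs xs1.
apply: (le_trans (ler_sum _ (fun k _ => hC (xs k)))).
by rewrite -mulr_sumr ler_wpM2l// big_split lerD ?fM ?gN.
Qed.

(* The restrictions of ys converge to ys in the weak* topology. *)
Definition restr_continuous f : Prop := forall ys (e : R), 0 < e ->
  exists2 S, finite_set S &
    forall S', S `<=` S' -> `|f ys - f (restr S' ys)| <= e.

Lemma restr_continuous_dom f g h (C : R) : 0 < C ->
  restr_continuous f -> restr_continuous g ->
  (forall ys zs, `|h ys - h zs| <= C * (`|f ys - f zs| + `|g ys - g zs|)) ->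
  restr_continuous h.
Proof.
move=> C0 fc gc hC ys e e0.
have e'0 : 0 < e / C / 2 by rewrite !divr_gt0.
have [S finS fS] := fc ys _ e'0; have [T finT gT] := gc ys _ e'0.
exists (S `|` T) => [|S' STS']; first by rewrite finite_setU.
apply: le_trans (hC _ _) _; rewrite mulrC -ler_pdivlMr//.
have := fS S' (subset_trans (@subsetUl _ S T) STS').
have := gT S' (subset_trans (@subsetUr _ S T) STS').
lra.
Qed.

Lemma delta_in_H0 x : in_l1 x -> in_H0 (delta x).
Proof.
move=> xl1; split; first exact: dpair_pos_homog.
apply: le_lt_trans xl1; apply: ge_ereal_sup => _ [n [xs [/admissibleP xs1 ->]]].
apply: le_trans (@sum_dpair_le _ _ _ (fun=> 1) _) _ => //.
by apply: le_esum => a _; rewrite mul1r.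
Qed.

Lemma delta_restr_continuous x : in_l1 x -> restr_continuous (delta x).
Proof.
move=> xl1 ys e e0; have [M M0 yM] := linf_boundP ys.
(* A tail of [x] below e / M offsets the bound M on [ys]. *)
have [S finS xS] := esum_tail (fun a => normr_ge0 (x a)) xl1 (divr_gt0 e0 M0).
exists S => // S' SS'.
rewrite /delta (dpair_restr S' ys xl1) addrAC subrr add0r -lee_fin.
apply: le_trans (dpair_abs_le _ _) _.
apply: (@le_trans _ _ (\esum_(a in ~` S) `|ys a * x a|%:E)%E).
  rewrite [leRHS]esum_mkcond; apply: le_esum => a _ /=.
  rewrite !in_setC; have [aS|aS] := boolP (a \in S).
    have -> : a \in S' by apply/mem_set/SS'/set_mem.
    by rewrite mul0r normr0.
  by case: ifP => _; rewrite ?mul0r ?normr0 ?lee_fin.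
apply: le_trans (esum_pairing_le _ x M0 yM) _.
rewrite muleC -lee_pdivlMr//; exact: ltW.
Qed.

(** Lattice operations are Lipschitz, so domination handles them. Norm limits are handled by uniform
    convergence on bounded sets of l_infty(A). *)
Lemma restr_continuous_sublattice :
  closed_sublattice [set f | in_H0 f /\ restr_continuous f].
Proof.
split; first by move=> f [].
have maxB (a b c d : R) :
    `|Num.max a b - Num.max c d| <= 1 * (`|a - c| + `|b - d|).
  rewrite mul1r ler_norml; have := ler_norm (a - c); have := ler_norm (b - d).
  have := lerNnormlW (lexx `|a - c|); have := lerNnormlW (lexx `|b - d|).
  by case: (ltP a b) => ?; case: (ltP c d) => ? ? ? ? ?; apply/andP; split; lra.
have maxD (a b : R) : `|Num.max a b| <= 1 * (`|a| + `|b|).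
  by have := maxB a b 0 0; rewrite maxxx !subr0.
have minE (a b : R) : Num.min a b = - Num.max (- a) (- b).
  by rewrite oppr_max !opprK.
have minB (a b c d : R) :
    `|Num.min a b - Num.min c d| <= 1 * (`|a - c| + `|b - d|).
  rewrite !minE opprK addrC; apply: le_trans (maxB _ _ _ _) _.
  by rewrite !opprK [- c + a]addrC [- d + b]addrC.
have minD (a b : R) : `|Num.min a b| <= 1 * (`|a| + `|b|).
  by have := minB a b 0 0; rewrite minxx !subr0.
split.
- move=> f g [Hf fc] [Hg gc]; split.
    apply: (@in_H0_dom f g _ 1) => // [ys zs lam l0 E|ys].
      by rewrite (Hf.1 _ _ _ l0 E) (Hg.1 _ _ _ l0 E) mulrDr.
    by rewrite mul1r ler_normD.
  apply: (@restr_continuous_dom f g _ 1) => // ys zs.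
  by rewrite opprD addrACA mul1r ler_normD.
- move=> c f [Hf fc]; split.
    apply: (@in_H0_dom f f _ `|c|) => // [ys zs lam l0 E|ys].
      by rewrite (Hf.1 _ _ _ l0 E) mulrCA.
    by rewrite normrM ler_wpM2l// lerDl.
  apply: (@restr_continuous_dom f f _ (`|c| + 1)) => // ys zs.
  by rewrite -mulrBr normrM ler_pM ?lerDl.
- move=> f g [Hf fc] [Hg gc]; split.
    apply: (@in_H0_dom f g _ 1) => // ys zs lam l0 E.
    by rewrite (Hf.1 _ _ _ l0 E) (Hg.1 _ _ _ l0 E) -maxr_pMr// ltW.
  exact: (@restr_continuous_dom f g _ 1).
- move=> f g [Hf fc] [Hg gc]; split.
    apply: (@in_H0_dom f g _ 1) => // ys zs lam l0 E.
    by rewrite (Hf.1 _ _ _ l0 E) (Hg.1 _ _ _ l0 E) -minr_pMr// ltW.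
  exact: (@restr_continuous_dom f g _ 1).
- move=> f Hf flim; split=> // ys e e0.
  have [M M0 yM] := linf_boundP ys.
  (* Norm distance e / 3 / M gives error at most e / 3 on the ball of radius M, which contains [ys]
     and all its restrictions. *)
  have [g [[Hg gc] gf]] := flim (e / 3 / M) ltac:(by rewrite !divr_gt0).
  have [S finS gS] := gc ys (e / 3) ltac:(lra).
  have gfh : pos_homog (fun zs => g zs - f zs).
    by move=> zs zs' lam l0 E; rewrite (Hf.1 _ _ _ l0 E) (Hg.1 _ _ _ l0 E) mulrBr.
  have gfM zs : (forall a, `|zs a| <= M) -> `|g zs - f zs| <= e / 3.
    move=> zM; have := fbl_norm_point_le gfh (ltW gf) (ltW M0) zM.
    by rewrite mulrC divfK ?gt_eqF.
  exists S => // S' SS'.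
  have := gS S' SS'; have := gfM _ yM.
  have /gfM : forall a, `|restr S' ys a| <= M.
    by move=> a /=; case: ifP => _; rewrite ?normr0 ?(ltW M0).
  rewrite !ler_norml => /andP[? ?] /andP[? ?] /andP[? ?].
  by apply/andP; split; lra.
Qed.

Lemma FBL_in_H0_restr_continuous f : FBL f -> in_H0 f /\ restr_continuous f.
Proof.
move=> /(_ _ restr_continuous_sublattice); apply => x xl1.
by split; [exact: delta_in_H0|exact: delta_restr_continuous].
Qed.

End FreeNorm.

(** * An l_1 majorant for a directed norm bounded set *)

Section Majorant.
Variables (R : realType) (A : choiceType) (a0 : A).
Variables (F : set (linf R A -> R)) (M : R).
Hypothesis Fph : forall f, F f -> pos_homog f.
Hypothesis Fge0 : forall f ys, F f -> 0 <= f ys.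
Hypothesis FM : forall f, F f -> (fbl_norm f <= M%:E)%E.
Hypothesis Fdir : upwards_directed F.

(** [R^o] is R as a module over itself: [V] consists of all families on A, and [D] is its subspace
    l_infty(A). *)
Let V : lmodType R := (A -> R^o) : lmodType R.
Let D : set V := [set v | bounded_fam v].

Let D0 : D 0. Proof. by exists 0 => a; rewrite normr0. Qed.

Let DD v w : D v -> D w -> D (v + w).
Proof.
move=> [B vB] [C wC]; exists (B + C) => a.
by apply: le_trans (ler_normD _ _) _; rewrite lerD.
Qed.

Let DZ (k : R) v : D v -> D (k *: v).
Proof.
move=> [B vB]; exists (`|k| * B) => a.
by rewrite /= normrM ler_wpM2l.
Qed.

(* If phi is linear and positive with phi 1 <= M and f <= phi \o abs for f in F,
   then phi v is at most each member of [upper v]. *)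
Let upper (v : V) : set R := [set r | exists (t : R) f (s : seq (linf R A)),
  [/\ F f, forall a, v a + \sum_(y <- s) `|y a| <= t &
      r = t * M - \sum_(y <- s) f y]].

Let upper_has_inf v : D v -> has_inf (upper v).
Proof.
move=> [B vB]; split.
  have [f Ff] := Fdir.1; exists (B * M), B, f, [::].
  split=> // [a|]; last by rewrite big_nil subr0.
  by rewrite big_nil addr0; apply: le_trans (ler_norm _) (vB a).
exists (- (B * M)) => _ [t [f [s [Ff st ->]]]].
have sB a : \sum_(y <- s) `|y a| <= t + B.
  by have := st a; have := lerNnormlW (vB a); lra.
(* The point [a0] enters here: some coordinate is needed to see that t + B is nonnegative. *)
have tB0 : 0 <= t + B by apply: le_trans (sB a0); apply: sumr_ge0.
have := fbl_norm_sum_seq_le (Fph Ff) (FM Ff) tB0 sB.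
rewrite (eq_bigr f) => [|y _]; last by rewrite ger0_norm ?Fge0.
by rewrite mulrDl; lra.
Qed.

(** Directedness is used here: a common majorant [h] replaces [f] and [g] on the concatenated
    list. *)
Let upperD v w r u : D v -> D w -> upper v r -> upper w u ->
  exists2 z, upper (v + w) z & z <= r + u.
Proof.
move=> _ _ [t [f [s [Ff st ->]]]] [t' [g [s' [Fg st' ->]]]].
have [h [Fh fh gh]] := Fdir.2 f g Ff Fg.
exists ((t + t') * M - \sum_(y <- s ++ s') h y).
  exists (t + t'), h, (s ++ s'); split=> // a.
  rewrite big_cat /= (_ : (v + w) a = v a + w a)//.
  by have := st a; have := st' a; lra.
rewrite big_cat /= mulrDl.
have : \sum_(y <- s) f y <= \sum_(y <- s) h y by apply: ler_sum.
have : \sum_(y <- s') g y <= \sum_(y <- s') h y by apply: ler_sum.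
lra.
Qed.

Let upperZ (k : R) v r : 0 < k -> D v -> upper v r ->
  exists2 z, upper (k *: v) z & z <= k * r.
Proof.
move=> k0 _ [t [f [s [Ff st ->]]]].
exists (k * t * M - \sum_(y <- map (scale_linf k) s) f y).
  exists (k * t), f, (map (scale_linf k) s); split=> // a.
  rewrite big_map /=; under eq_bigr do rewrite normrM gtr0_norm//.
  by rewrite -mulr_sumr -mulrDr ler_pM2l.
rewrite big_map; under eq_bigr => y _ do
  rewrite (Fph Ff (zs := scale_linf k y) k0 (fun a => erefl)).
by rewrite -mulr_sumr mulrBr mulrA.
Qed.

(** The coefficients are the values of the Hahn-Banach functional at the basis vectors; each claim
    follows from one explicit member of an [upper] set. *)
Lemma l1_majorant : exists c : A -> R, [/\ forall a, 0 <= c a,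
  (l1norm c <= M%:E)%E &
  forall f ys S, F f -> finite_set S ->
    f (restr S ys) <= \sum_(a \in S) `|ys a| * c a].
Proof.
have [p [pD pZ pq]] := hahn_banach_additive D0 DD DZ
  (inf_sublinear_on DD DZ upper_has_inf upperD upperZ).
have p_le v r : D v -> upper v r -> p v <= r.
  move=> Dv vr; apply: le_trans (pq v Dv) _.
  by apply: ge_inf => //; exact: (upper_has_inf Dv).2.
have p0 : p 0 = 0 by have := pD 0 0 D0 D0; rewrite addr0; lra.
have DN v : D v -> D (- v) by move=> /(DZ (-1)); rewrite scaleN1r.
have pN v : D v -> p (- v) = - p v.
  by move=> Dv; have := pD _ _ Dv (DN v Dv); rewrite subrr p0; lra.
have pZ0 k v : 0 <= k -> D v -> p (k *: v) = k * p v.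
  rewrite le_eqVlt => /predU1P[<-|] *; last exact: pZ.
  by rewrite scale0r p0 mul0r.
pose e a : V := basis R a.
have De a : D (e a).
  by exists 1 => b; rewrite /e /basis; case: eqP; rewrite ?normr1 ?normr0.
(* Evaluates [p] at a finitely supported nonnegative family. *)
have psum (w : A -> R) (r : seq A) : (forall a, 0 <= w a) -> uniq r ->
    D (fun b => if b \in r then w b else 0) /\
    p (fun b => if b \in r then w b else 0) = \sum_(a <- r) w a * p (e a).
  move=> w0; elim: r => [_|a r IH /= /andP[ar /IH[Dr pr]]].
    by rewrite big_nil; split; [exact: D0|exact: p0].
  rewrite (_ : (fun b => _) = w a *: e a + (fun b => if b \in r then w b else 0)).
    split; first exact: (DD (DZ _ (De a)) Dr).
    by rewrite pD ?pZ0// ?pr ?big_cons//; exact/DZ.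
  apply/funext => b; rewrite in_cons /e /basis.
  rewrite -[RHS]/(w a * (b == a)%:R + (if b \in r then w b else 0)).
  case: eqVneq => [->|_]; first by rewrite (negPf ar) mulr1 addr0.
  by rewrite mulr0 add0r.
have [f0 Ff0] := Fdir.1.
have c0 a : 0 <= p (e a).
  rewrite -oppr_le0 -pN//; apply: p_le; first exact: DN.
  (* Since - e a <= 0, the choice t = 0 with the empty list gives the member 0. *)
  exists 0, f0, [::]; split=> // [b|]; last by rewrite big_nil mul0r subr0.
  by rewrite big_nil addr0 oppr_le0 /e /basis.
exists (fun a => p (e a)); split=> //.
- apply: ge_ereal_sup => _ [S [finS _] <-].
  rewrite fsumEFin// lee_fin fsbig_finite//=.
  have [DS pS] := psum (fun=> 1) _ (fun=> ler01) (fset_uniq (fset_set S)).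
  under eq_bigr do rewrite ger0_norm//.
  under [leLHS]eq_bigr do rewrite -[p _]mul1r.
  rewrite -pS; apply: p_le => //.
  (* An indicator is at most 1, so t = 1 with the empty list gives the member M. *)
  exists 1, f0, [::]; split=> // [b|]; last by rewrite big_nil mul1r subr0.
  by rewrite big_nil addr0; case: ifP.
- move=> f ys S Ff finS.
  rewrite fsbig_finite//.
  have [DS <-] := psum (fun a => `|ys a|) _ (fun=> normr_ge0 _)
    (fset_uniq (fset_set S)).
  rewrite -lerN2 -pN//; apply: p_le; first exact: DN.
  (* Minus |ys| on S cancels the modulus of the restriction, so t = 0 gives the member - f (restr S
     ys). *)
  exists 0, f, [:: restr S ys]; split=> // [a|]; last first.
    by rewrite big_seq1 mul0r sub0r.
  rewrite big_seq1 -[X in X + _]/(- (if a \in fset_set S then `|ys a| else 0)) /=.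
  by rewrite in_fset_set//; case: ifP; rewrite ?normr0 addNr.
Qed.

End Majorant.

(** * The series of c_a |delta_a| as an element of FBL *)

Section WeightedModulus.
Variables (R : realType) (A : choiceType) (c : A -> R).
Hypothesis c0 : forall a, 0 <= c a.
Hypothesis cl1 : in_l1 c.

(** The sum of c_a |delta_a|, written as a pairing so that the duality estimates apply. *)
Definition weighted_modulus (ys : linf R A) : R := dpair (abs_linf ys) c.

Let dpair_nonneg (ys : linf R A) : (forall a, 0 <= ys a) ->
  dpair ys c = fine (\esum_(a in [set: A]) (ys a * c a)%:E)%E.
Proof.
move=> y0; rewrite /dpair [X in _ - fine X]esum1 ?subr0; last first.
  by move=> a _; rewrite max_r// oppr_le0 mulr_ge0.
by congr fine; apply: eq_esum => a _; rewrite max_l// mulr_ge0.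
Qed.

Lemma fin_weighted_modulus_le (ys : linf R A) S : finite_set S ->
  \sum_(a \in S) `|ys a| * c a <= weighted_modulus ys.
Proof.
move=> finS; rewrite /weighted_modulus dpair_nonneg; last by move=> a /=.
rewrite -lee_fin fineK; last first.
  rewrite ge0_fin_numE; last by apply: esum_ge0 => a _; rewrite lee_fin mulr_ge0 /=.
  apply: le_lt_trans (summable_pairing (abs_linf ys) cl1).
  by apply: le_esum => a _; rewrite lee_fin ler_norm.
by rewrite -fsumEFin//; apply: ereal_sup_ubound; exists S.
Qed.

Lemma dpair_restr_abs (ys : linf R A) S : finite_set S ->
  dpair (restr S (abs_linf ys)) c = \sum_(a \in S) c a * `|ys a|.
Proof.
move=> finS; rewrite dpair_nonneg => [|a /=]; last by case: ifP.
have -> : (\esum_(a in [set: A]) (restr S (abs_linf ys) a * c a)%:E =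
           \esum_(a in S) (c a * `|ys a|)%:E)%E.
  rewrite [RHS]esum_mkcond; apply: eq_esum => a _ /=.
  by case: ifP => _; rewrite ?mul0r// mulrC.
rewrite esum_fset//; last by move=> a _; rewrite lee_fin mulr_ge0 /=.
by rewrite fsumEFin.
Qed.

Let sum_abs_le1 n (xs : 'I_n -> linf R A) :
  (forall a, \sum_(k < n) `|xs k a| <= 1) ->
  forall a, \sum_(k < n) `|abs_linf (xs k) a| <= 1.
Proof. by move=> + a => /(_ a); under [leLHS]eq_bigr do rewrite -normr_id. Qed.

Lemma fbl_norm_weighted_modulus_le :
  (fbl_norm weighted_modulus <= l1norm c)%E.
Proof.
apply: ge_ereal_sup => _ [n [xs [/admissibleP/sum_abs_le1 xs1 ->]]].
apply: le_trans (sum_dpair_le (w := fun=> 1) _ xs1) _.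
by apply: le_esum => a _; rewrite mul1r.
Qed.

(** Finite partial sums lie in every closed sublattice containing the evaluations, and the remainder
    off T has norm at most the l_1 tail of c. *)
Lemma FBL_weighted_modulus : FBL weighted_modulus.
Proof.
move=> S [_ [SD SZ Smax _ Slim]] Sdelta; apply: Slim.
  split; last exact: le_lt_trans fbl_norm_weighted_modulus_le cl1.
  move=> ys zs lam lam0 zsE; apply: dpair_pos_homog => // a /=.
  by rewrite zsE normrM gtr0_norm.
move=> e e0.
have [T finT cT] := esum_tail (fun a => normr_ge0 (c a)) cl1 e0.
exists (fun ys => dpair (restr T (abs_linf ys)) c); split.
- rewrite (_ : (fun ys => _) =
    fun ys : linf R A => \sum_(a <- fset_set T) c a * `|ys a|); last first.
    by apply/funext => ys; rewrite dpair_restr_abs// fsbig_finite.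
  elim: (enum_fset (fset_set T)) => [|a r IH].
    (* The zero function is obtained as a multiple of an evaluation. *)
    rewrite (_ : (fun ys => _) = fun ys : linf R A => 0 * delta (fun=> 0) ys).
      apply/SZ/Sdelta; rewrite /in_l1 /l1norm esum1 ?ltry// => a _.
      by rewrite normr0.
    by apply/funext => ys; rewrite big_nil mul0r.
  (* The modulus |delta_a| is the maximum of delta_a and - delta_a. *)
  rewrite (_ : (fun ys => _) = fun ys : linf R A =>
      c a * Num.max (delta (basis R a) ys) (-1 * delta (basis R a) ys) +
      \sum_(b <- r) c b * `|ys b|).
    have Sa : S (delta (basis R a)) by apply: Sdelta; rewrite /in_l1 l1norm_basis ltry.
    exact/SD/IH/SZ/(Smax _ _ Sa)/SZ.
  apply/funext => ys; rewrite big_cons /delta dpair_basis mulN1r.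
  by have /orP[y0|y0] := le_total 0 (ys a);
    [rewrite ger0_norm// max_l// (le_trans _ y0)// oppr_le0|
     rewrite ler0_norm// max_r// (le_trans y0)// oppr_ge0].
- apply: le_lt_trans cT; apply: ge_ereal_sup => _ [n [xs [adm ->]]].
  move: adm => /admissibleP/sum_abs_le1 xs1.
  apply: le_trans (sum_dpair_restr_le c (~` T) xs1).
  rewrite lee_fin; apply: ler_sum => k _.
  by rewrite /weighted_modulus (dpair_restr T (abs_linf (xs k)) cl1) opprD addrA subrr add0r normrN.
Qed.

End WeightedModulus.

(** * The strong Nakano property *)

Theorem theorem4p11 (R : realType) (A : choiceType) (a0 : A)
    (F : set (linf R A -> R)) :
  F `<=` FBL_pos (A:=A) ->
  upwards_directed F -> norm_bounded F ->
  exists y0 : linf R A -> R,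
    [/\ FBL y0, (forall f, F f -> fle f y0) &
        fbl_norm y0 = ereal_sup [set fbl_norm f | f in F]].
Proof.
move=> FP Fdir [N FN]; have [f0 Ff0] := Fdir.1.
set s := ereal_sup _.
have s_fin : s \is a fin_num.
  rewrite ge0_fin_numE; last first.
    by apply: le_trans (fbl_norm_ge0 f0) _; apply: ereal_sup_ubound; exists f0.
  apply: le_lt_trans (ltry N).
  by apply: ge_ereal_sup => _ [f Ff <-]; exact: FN.
have FH f : F f -> in_H0 f /\ restr_continuous f.
  by move=> /FP[/FBL_in_H0_restr_continuous].
have Fge0 f ys : F f -> 0 <= f ys by move=> /FP[].
have Fs f : F f -> (fbl_norm f <= (fine s)%:E)%E.
  by move=> Ff; rewrite fineK//; apply: ereal_sup_ubound; exists f.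
(* The bound M is the exact supremum [fine s], so that the l_1 norm of [c] is at most s. *)
have [c [c0 cs cF]] :=
  l1_majorant a0 (fun f Ff => (FH f Ff).1.1) Fge0 Fs Fdir.
have cl1 : in_l1 c by exact: le_lt_trans cs (ltry _).
have Fle f : F f -> fle f (weighted_modulus c).
  move=> Ff ys; apply/ler_addgt0Pr => e e0.
  (* f ys <= f (restr S ys) + e, and the finite sum bounding f (restr S ys) is at most the full
     series. *)
  have [S finS fS] := (FH f Ff).2 ys e e0.
  have := fS S (fun=> id); rewrite ler_distlC => /andP[+ _].
  have := cF f ys S Ff finS.
  by have := fin_weighted_modulus_le c0 cl1 ys finS; lra.
exists (weighted_modulus c); split=> //; first exact: FBL_weighted_modulus.
apply/eqP; rewrite eq_le; apply/andP; split.
  apply: le_trans (fbl_norm_weighted_modulus_le c) _.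
  by rewrite -(fineK s_fin).
(* Conversely the norm is monotone on positive elements, and 0 <= f <= y0. *)
apply: ge_ereal_sup => _ [f Ff <-].
apply: ge_ereal_sup => _ [n [xs [adm ->]]].
apply: (@le_trans _ _ (\sum_(k < n) `|weighted_modulus c (xs k)|)%:E); last first.
  by apply: ereal_sup_ubound; exists n, xs.
rewrite lee_fin; apply: ler_sum => k _.
have fy := Fle f Ff (xs k); have fk := Fge0 f (xs k) Ff.
by rewrite !ger0_norm// (le_trans fk).
Qed.
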